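(* Let $(X,\rho)$ be a discrete countable metric space with polynomial dimension growth, i.e. the asymptotic dimension function $ad_X(\lambda)$ is bounded from above by a polynomial in $\lambda$. Then $X$ has property $A$.
   Context: Let $(X,\rho)$ be a metric space and $\mathcal{U}$ a cover of $X$ (by subsets). A number $\lambda>0$ is a Lebesgue number for $\mathcal{U}$ if for every set $A\subset X$ of diameter $\le\lambda$ there is $U\in\mathcal{U}$ with $A\subset U$. $L(\mathcal{U})$ denotes the supremum of all Lebesgue numbers of $\mathcal{U}$. The multiplicity $m(\mathcal{U})$ is the maximal number of elements of $\mathcal{U}$ with a nonempty intersection. $\mathcal{U}$ is uniformly bounded if $\operatorname{diam}(\mathcal{U})=\sup\{\operatorname{diam}(U)\mid U\in\mathcal{U}\}<\infty$. The asymptotic dimension function of $X$ is $$ad_X(\lambda)=\min\{m(\mathcal{U})\mid \mathcal{U}\text{ a uniformly bounded cover of }X,\ L(\mathcal{U})\ge\lambda\}-1.$$ Property $A$ means property $A_1$, defined as follows. For a countable set $Z$, $\ell_1(Z)$ is the Banach space of functions $a:Z\to\mathbb{R}$ with $\|a\|_1=\sum_{y\in Z}|a(y)|<\infty$. A discrete metric space $(X,d)$ has property $A_1$ if there is a sequence of maps $a^n:X\to\ell_1(X)$, $z\mapsto a^n_z$, $n\in\mathbb{N}$, with $\|a^n_z\|_1=1$ and $a^n_z(y)\ge 0$ for all $y,z\in X$, such that (1) there is a function $R=R(n)$ such that $\operatorname{supp}(a^n_z)\subset B_{R(n)}(z)$ for all $z\in X$ and all $n$; (2) for every $K>0$, $\lim_{n\to\infty}\sup_{d(z,w)<K}\|a^n_z-a^n_w\|_1=0$.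 *)

(* Defs.v *)
From HB Require Import structures.
From mathcomp Require Import all_boot all_order all_algebra.
From mathcomp Require Import all_classical all_reals all_analysis.

Set Implicit Arguments.
Unset Strict Implicit.
Unset Printing Implicit Defensive.

Import Order.TTheory GRing.Theory Num.Theory.
Import numFieldNormedType.Exports.

Local Open Scope classical_set_scope.
Local Open Scope ring_scope.

Section Sup.
Context {R : realType}.

(* Every supremum below is of nonnegative quantities and is taken in [0, +oo];
   adding 0 to the set only matters for the empty set, where the library's
   ereal_sup is -oo. *)
Definition nneg_sup (S : set (\bar R)) : \bar R := ereal_sup (0%E |` S).

End Sup.

Section AsymptoticDimensionFunction.
Context {R : realType} {X : metricType R}.
Implicit Types (A : set X) (U F : set (set X)) (l : R).

Definition diam A : \bar R :=
  nneg_sup [set (mdist p.1 p.2)%:E | p in A `*` A].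

Definition is_cover U : Prop := \bigcup_(A in U) A = [set: X].

Definition uniformly_bounded U : Prop :=
  (nneg_sup [set diam A | A in U] < +oo)%E.

Definition lebesgue_number U l : Prop :=
  0 < l /\
  forall A, (diam A <= l%:E)%E -> exists2 V, U V & A `<=` V.

Definition sup_lebesgue_number U : \bar R :=
  nneg_sup [set l%:E | l in lebesgue_number U].

(* +oo when arbitrarily many members of U have a common point. *)
Definition multiplicity U : \bar R :=
  nneg_sup [set n%:R%:E | n in
    [set n : nat | exists F,
      [/\ F `<=` U, (F #= `I_n)%card & \bigcap_(A in F) A !=set0]]].

End AsymptoticDimensionFunction.

(* Multiplicities lie in {0, 1, 2, ...} U {+oo}, so the infimum is attained
   whenever the set is nonempty; it is +oo when no such cover exists. *)
Definition asdim_fun {R : realType} (X : metricType R) (l : R) : \bar R :=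
  (ereal_inf [set multiplicity U | U in
     [set U : set (set X) |
       [/\ is_cover U, uniformly_bounded U &
           (l%:E <= sup_lebesgue_number U)%E]]] - 1)%E.

Definition polynomial_dimension_growth {R : realType} (X : metricType R) :
    Prop :=
  exists p : {poly R}, forall l : R, 0 < l -> (asdim_fun X l <= p.[l]%:E)%E.

Section PropertyA.
Context {R : realType}.

Definition ell1 (Z : choiceType) : set (Z -> R) :=
  [set a | summable [set: Z] (fun y => (a y)%:E)].

Definition ell1_norm (Z : choiceType) (a : Z -> R) : \bar R :=
  \esum_(y in [set: Z]) `|a y|%:E.

Definition property_A (X : metricType R) : Prop :=
  exists a : nat -> X -> X -> R,
    [/\ forall n z, ell1 (a n z),
        forall n z, ell1_norm (a n z) = 1%E /\ forall y, 0 <= a n z y,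
        exists r : nat -> R, forall n z,
          [set y | a n z y != 0] `<=` ball z (r n) &
        forall K : R, 0 < K ->
          nneg_sup [set ell1_norm (fun y => a n p.1 y - a n p.2 y) | p in
                     [set p : X * X | mdist p.1 p.2 < K]]
            @[n --> \oo] --> (0%E : \bar R)].

End PropertyA.

(* Main.v *)
(** Take a cover [U] of multiplicity at most [b] such that every ball of radius
    [N] lies in a member of [U], and let [h_A(z)] be the largest [j <= N] with
    [ball z j] included in [A].  Each [h_A] varies by at most [k] between points
    at distance at most [k], and [max_A h_A(z) = N].  The naive weights
    [h_A / sum h] only vary by [O(b k / N)], which is useless when [b] grows at
    least linearly in [N]; the weights [h_A^(q+1) / sum h^(q+1)] do better: the
    change is controlled by [(q+1) k sum h^q / sum h^(q+1)], and the inequality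
    [t h^q <= h^(q+1) + t^(q+1)] bounds [sum h^q / sum h^(q+1)] by [O(1/t)] as
    soon as [b t^(q+1) = O(N^(q+1))].  With [b = O(t^q)] and [N = t^2] this
    holds.  Moving the weight of [A] to a chosen point of [A] gives the maps of
    property A. *)

Require Import Defs.
From mathcomp Require Import all_boot all_order all_algebra.
From mathcomp Require Import all_classical all_reals all_analysis.
From mathcomp Require Import finmap ring lra.

Import Order.TTheory GRing.Theory Num.Theory.
Import numFieldNormedType.Exports.

Local Open Scope classical_set_scope.
Local Open Scope ring_scope.

(** * Two inequalities between consecutive powers *)

Lemma ler_dist_expS (R : realDomainType) (x y d : R) (q : nat) :
  0 <= x -> 0 <= y -> `|x - y| <= d ->
  `|x ^+ q.+1 - y ^+ q.+1| <= q.+1%:R * d * (x ^+ q + y ^+ q).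
Proof.
wlog xy : x y / y <= x => [hw x0 y0 xyd|x0 y0 xyd].
  have [/hw|/ltW/hw] := leP y x; first exact.
  move=> hyx; rewrite distrC [x ^+ q + _]addrC.
  by apply: hyx => //; rewrite distrC.
(* After factoring out [x - y], the cofactor has [q.+1] terms, each at most [x ^+ q] because
   [y <= x]. *)
rewrite subrXX normrM -mulrA mulrCA ler_pM ?normr_ge0//.
rewrite ger0_norm; last by apply: sumr_ge0 => i _; rewrite mulr_ge0 ?exprn_ge0.
rewrite mulr_natl -[q.+1 in leRHS]card_ord -sumr_const.
apply: ler_sum => i _; rewrite (@le_trans _ _ (x ^+ q)) ?lerDl ?exprn_ge0//.
have iq : (i <= q)%N by rewrite -ltnS.
rewrite /= -[q in leRHS](subnK iq) exprD.
by rewrite ler_wpM2l ?exprn_ge0 ?lerXn2r.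
Qed.

Lemma exprS_threshold (R : realDomainType) (x t : R) (q : nat) :
  0 <= x -> 0 <= t -> t * x ^+ q <= x ^+ q.+1 + t ^+ q.+1.
Proof.
move=> x0 t0; have [tx|/ltW xt] := leP t x.
  by rewrite exprS ler_wpDr ?exprn_ge0// ler_wpM2r ?exprn_ge0.
by rewrite [t ^+ _]exprS ler_wpDl ?exprn_ge0// ler_wpM2l ?lerXn2r.
Qed.

(** * Variation of normalized power weights *)

Section Weights.
Context {R : realFieldType} {I : Type}.
Implicit Types (s : seq I) (u v g h : I -> R).

(** Changing the numerator and changing the normalizer each cost at most [e / b]. Only the total of
    [v] enters the bound, so the larger of the two totals can be put there. *)
Lemma sum_dist_normalized s u v :
  (forall i, 0 <= u i) -> 0 < \sum_(i <- s) u i -> 0 < \sum_(i <- s) v i ->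
  \sum_(i <- s) `|u i / (\sum_(i <- s) u i) - v i / (\sum_(i <- s) v i)| <=
    2 * (\sum_(i <- s) `|u i - v i|) / \sum_(i <- s) v i.
Proof.
move=> u0; set a := \sum_(i <- s) u i; set b := \sum_(i <- s) v i => a0 b0.
set e := \sum_(i <- s) `|u i - v i|.
have abe : `|b - a| <= e.
  by rewrite distrC /a /b -sumrB; exact: ler_norm_sum.
apply: (@le_trans _ _ (\sum_(i <- s) (u i * (e / (a * b)) + `|u i - v i| / b))).
  apply: ler_sum => i _.
  have -> : u i / a - v i / b = u i * ((b - a) / (a * b)) + (u i - v i) / b.
    by field; rewrite !gt_eqF.
  rewrite (le_trans (ler_normD _ _))// lerD//.
    rewrite !normrM (ger0_norm (u0 i)) ler_wpM2l// normfV normrM.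
    by rewrite (gtr0_norm a0) (gtr0_norm b0) ler_pM2r// invr_gt0 mulr_gt0.
  by rewrite normrM normfV (gtr0_norm b0).
rewrite big_split/= -!mulr_suml -/a -/e.
rewrite le_eqVlt; apply/orP; left; apply/eqP.
by field; rewrite !gt_eqF.
Qed.

Lemma sum_dist_power_weights s g h (q : nat) (c d t M : R) :
  (forall i, 0 <= g i) -> (forall i, 0 <= h i) ->
  (forall i, `|g i - h i| <= d) ->
  0 < t -> 0 < M ->
  (size s)%:R * t ^+ q.+1 <= c * M ->
  0 <= c -> 0 <= d ->
  M <= \sum_(i <- s) g i ^+ q.+1 -> M <= \sum_(i <- s) h i ^+ q.+1 ->
  \sum_(i <- s) `|g i ^+ q.+1 / (\sum_(i <- s) g i ^+ q.+1) -
                  h i ^+ q.+1 / (\sum_(i <- s) h i ^+ q.+1)| <=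
    4 * q.+1%:R * d * (1 + c) / t.
Proof.
move=> + + + t0 M0 sM c0 d_ge0.
set a := fun g : I -> R => \sum_(i <- s) g i ^+ q.+1.
rewrite -/(a g) -/(a h).
(* The larger total serves as denominator, so that it dominates the sums of both [g] and [h]. *)
wlog gh : g h / a g <= a h => [hw g0 h0 ghd Mg Mh|g0 h0 ghd Mg Mh].
  have [/hw|/ltW/hw] := leP (a g) (a h); first exact.
  move=> hw1; under eq_bigr do rewrite distrC.
  by apply: hw1 => // i; rewrite distrC.
have h_gt0 := lt_le_trans M0 Mh.
apply: (le_trans (sum_dist_normalized s (fun i => g i ^+ q.+1)
  (fun i => h i ^+ q.+1) (fun i => exprn_ge0 _ (g0 i)) (lt_le_trans M0 Mg)
  h_gt0)).
rewrite ler_pdivrMr//.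
(* Summing [exprS_threshold] gives [t * \sum f ^+ q <= a f + size s * t ^+ q.+1], which is at most
   [a h + c * M <= (1 + c) * a h]. *)
have bd f : (forall i, 0 <= f i) -> a f <= a h ->
    \sum_(i <- s) f i ^+ q <= (1 + c) * a h / t.
  move=> f0 fh; rewrite ler_pdivlMr// mulrC mulr_sumr.
  apply: (@le_trans _ _ (\sum_(i <- s) (f i ^+ q.+1 + t ^+ q.+1))).
    by apply: ler_sum => i _; apply: exprS_threshold; rewrite ?f0 ?ltW.
  rewrite big_split/= mulrDl mul1r lerD//.
  rewrite big_const_seq count_predT iter_addr_0 -mulr_natl.
  by rewrite (le_trans sM)// ler_wpM2l.
have d0 : \sum_(i <- s) `|g i ^+ q.+1 - h i ^+ q.+1| <=
    q.+1%:R * d * (\sum_(i <- s) g i ^+ q + \sum_(i <- s) h i ^+ q).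
  rewrite -big_split mulr_sumr; apply: ler_sum => i _ /=.
  exact: ler_dist_expS.
rewrite (_ : 4 * _ * _ * _ / _ * _ =
    2 * (q.+1%:R * d * ((1 + c) * a h / t + (1 + c) * a h / t))); last first.
  by rewrite -/(a h); field; rewrite gt_eqF.
rewrite ler_wpM2l// (le_trans d0)// ler_wpM2l ?mulr_ge0//.
by rewrite lerD// bd.
Qed.
End Weights.

(** * Push-forward of finitely supported weights *)

Section FiberSum.
Context {R : realType} {I Z : choiceType}.
Variable c : I -> Z.
Implicit Types (s : seq I) (w : I -> R).

Definition fiber_sum s w (y : Z) : R := \sum_(i <- s | c i == y) w i.

Lemma fiber_sumE s w y :
  fiber_sum s w y = \sum_(i <- s) (if c i == y then w i else 0).
Proof. by rewrite /fiber_sum big_mkcond. Qed.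

Lemma fiber_sum_ge0 s w y : (forall i, 0 <= w i) -> 0 <= fiber_sum s w y.
Proof. by move=> w0; exact: sumr_ge0. Qed.

Lemma fiber_sumB s w w' y :
  fiber_sum s (fun i => w i - w' i) y = fiber_sum s w y - fiber_sum s w' y.
Proof. by rewrite /fiber_sum sumrB. Qed.

(** After exchanging the sums, each [i] contributes to the single point [c i]. *)
Lemma ell1_norm_fiber_sum s w : (forall i, 0 <= w i) ->
  ell1_norm (fiber_sum s w) = (\sum_(i <- s) w i)%:E.
Proof.
move=> w0; rewrite /ell1_norm.
under eq_esum => y _.
  rewrite ger0_norm ?fiber_sum_ge0// fiber_sumE -sumEFin; over.
rewrite esum_sum => [|y i _ _]; last by case: ifP; rewrite lee_fin.
rewrite -sumEFin; apply: eq_bigr => i _.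
rewrite -(@esum_set1 _ _ (c i) (fun=> (w i)%:E)) ?lee_fin//.
rewrite [RHS]esum_mkcond; apply: eq_esum => y _; rewrite eq_sym.
by case: eqVneq => [->|yc]; [rewrite mem_set|rewrite memNset//; apply/eqP].
Qed.

Lemma ell1_norm_fiber_sum_le s w :
  (ell1_norm (fiber_sum s w) <= (\sum_(i <- s) `|w i|)%:E)%E.
Proof.
rewrite -ell1_norm_fiber_sum//; apply: le_esum => y _.
rewrite lee_fin [leRHS]ger0_norm ?fiber_sum_ge0//.
exact: ler_norm_sum.
Qed.

Lemma summable_fiber_sum s w : ell1 (fiber_sum s w).
Proof.
by rewrite /ell1/= /summable (le_lt_trans (ell1_norm_fiber_sum_le s w))// ltry.
Qed.

End FiberSum.

(** * Truncated depth of a point in a set *)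

Section Depth.
Context {R : realType} {X : metricType R}.
Implicit Types (A : set X) (x y z : X).

(** Balls are open, so the ball of radius 0 is empty and [j = 0] is always admissible, even for [z]
    outside [A]. *)
Definition depth (N : nat) A z : nat :=
  \max_(j < N.+1 | `[< ball z j%:R `<=` A >]) j.

Lemma ball_depth N A z : ball z (depth N A z)%:R `<=` A.
Proof.
rewrite /depth; elim/big_ind : _ => [|i j iA jA|i /asboolP//].
  by rewrite ballEmdist => y /=; rewrite ltNge mdist_ge0.
by rewrite /maxn; case: ifP.
Qed.

Lemma depth_eq0 N A z : ~ A z -> depth N A z = 0.
Proof.
move=> Az; apply/eqP; rewrite -leqn0 leqNgt; apply/negP => d0; apply: Az.
by apply: (@ball_depth N); apply: ballxx; rewrite ltr0n.
Qed.

Lemma depth_ball N A z : ball z N%:R `<=` A -> (N <= depth N A z)%N.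
Proof.
move=> zA.
apply: (@leq_bigmax_cond _ _ (fun i : 'I_N.+1 => i : nat) ord_max).
exact/asboolP.
Qed.

(** If [ball x j] lies in [A], so does the smaller [ball y (j - k)]; truncation at [N] does no harm
    since [j - k <= N]. *)
Lemma depth_lipschitz N A x y (k : nat) : mdist x y <= k%:R ->
  (depth N A x <= depth N A y + k)%N.
Proof.
move=> xy; apply/bigmax_leqP => -[j/= jN] /asboolP xA.
have [jk|kj] := leqP j k; first by rewrite (leq_trans jk)// leq_addl.
rewrite addnC -leq_subLR.
have jkN : (j - k < N.+1)%N by rewrite (leq_ltn_trans (leq_subr _ _)).
apply: (@leq_bigmax_cond _ _ (fun i : 'I_N.+1 => i : nat) (Ordinal jkN)).
apply/asboolP; apply: subset_trans xA => z.
rewrite !ballEmdist/= natrB ?(ltnW kj)// ltrBrDr addrC; apply: le_lt_trans.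
by rewrite (le_trans (metric_triangle x y z))// lerD2r.
Qed.

End Depth.

(** * Covers obtained from the asymptotic dimension function *)

Lemma nneg_sup_ge0 {R : realType} (S : set (\bar R)) : (0 <= nneg_sup S)%E.
Proof. by apply: ereal_sup_ubound; left. Qed.

Lemma nneg_sup_ubound {R : realType} (S : set (\bar R)) x :
  S x -> (x <= nneg_sup S)%E.
Proof. by move=> Sx; apply: ereal_sup_ubound; right. Qed.

Lemma nneg_sup_le {R : realType} (S : set (\bar R)) x :
  (0 <= x)%E -> (forall y, S y -> (y <= x)%E) -> (nneg_sup S <= x)%E.
Proof. by move=> x0 Sx; apply: ge_ereal_sup => y [->//|/Sx]. Qed.

Lemma horner_le_exp {R : realFieldType} (p : {poly R}) (x : R) : 1 <= x ->
  p.[x] <= (\sum_(i < size p) `|p`_i|) * x ^+ size p.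
Proof.
move=> x1; rewrite horner_coef mulr_suml; apply: ler_sum => i _.
rewrite (le_trans (ler_norm _))// normrM ler_wpM2l//.
rewrite ger0_norm ?exprn_ge0 ?(le_trans _ x1)//.
by rewrite ler_weXn2l// ltnW.
Qed.

Section Covers.
Context {R : realType} {X : metricType R}.
Implicit Types (U : set (set X)).

Lemma uniformly_boundedP U : uniformly_bounded U ->
  exists d : R, forall A, U A -> forall x y, A x -> A y -> mdist x y <= d.
Proof.
rewrite /uniformly_bounded; set s := nneg_sup _ => sy.
have sfin : s \is a fin_num by rewrite ge0_fin_numE// nneg_sup_ge0.
exists (fine s) => A UA x y Ax Ay; rewrite -lee_fin fineK//.
apply: (@le_trans _ _ (diam A)); last by apply: nneg_sup_ubound; exists A.
by apply: nneg_sup_ubound; exists (x, y).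
Qed.

(** The supremum need not be a Lebesgue number, but the strict [r *+ 2 < l] leaves room for one
    above [r *+ 2], which bounds the diameter of the ball. *)
Lemma sup_lebesgue_number_ball U (l r : R) : 0 < l -> r *+ 2 < l ->
  (l%:E <= sup_lebesgue_number U)%E ->
  forall x, exists2 A, U A & ball x r `<=` A.
Proof.
move=> l0 rl lU x.
(* The maximum with 0 excludes the extra element 0 of [nneg_sup]. *)
have : (Order.max 0%E (r *+ 2)%:E < sup_lebesgue_number U)%E.
  by rewrite (lt_le_trans _ lU)// gt_max !lte_fin l0.
move=> /ereal_sup_gt[_ [->|[l' [l'0 l'U] <-]]].
  by rewrite gt_max ltxx.
rewrite gt_max => /andP[_]; rewrite lte_fin => /ltW rl'.
apply: l'U; apply: nneg_sup_le; first by rewrite lee_fin ltW.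
move=> _ [[y z]/= [+ +] <-]; rewrite !ballEmdist lee_fin/= => xy xz.
rewrite (le_trans _ rl')// (le_trans (metric_triangle y x z))// mulr2n.
by rewrite lerD// ?ltW// metric_sym.
Qed.

Lemma multiplicity_card U (b : R) x (F : {fset (set X)}) :
  (multiplicity U <= b%:E)%E ->
  (forall A, A \in F -> U A /\ A x) -> #|` F|%:R <= b.
Proof.
move=> Ub FU; rewrite -lee_fin (le_trans _ Ub)//.
apply: nneg_sup_ubound; exists #|` F| => //; exists [set` F]; split.
- by move=> A /= /FU[].
- exact/card_eq_fsetP.
- by exists x => A /= /FU[].
Qed.

Lemma multiplicity_finite U (b : R) x : (multiplicity U <= b%:E)%E ->
  finite_set (U `&` [set A | A x]).
Proof.
move=> Ub; apply: contrapT => /(@infinite_set_fset _ _ (Num.bound b))[F FU].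
rewrite leqNgt => /negP; apply; rewrite -(ltr_nat R).
have b0 : 0 <= b.
  by rewrite -lee_fin (le_trans _ Ub)// nneg_sup_ge0.
by rewrite (le_lt_trans _ (archi_boundP b0))// (@multiplicity_card U _ x).
Qed.

(** In [b + 2], one unit undoes the [- 1] of [asdim_fun]; the other makes the inequality strict, so
    that a cover can be drawn from the infimum. *)
Lemma asdim_fun_cover (l b : R) : (asdim_fun X l <= b%:E)%E ->
  exists U : set (set X), [/\ uniformly_bounded U,
    (l%:E <= sup_lebesgue_number U)%E & (multiplicity U <= (b + 2)%:E)%E].
Proof.
rewrite /asdim_fun leeBlDr// => lb.
have : ((b + 1)%:E < (b + 2)%:E)%E by rewrite lte_fin ltrD2l ltr1n.
rewrite EFinD => /(le_lt_trans lb)/ereal_inf_lt[_ [U [_ bU lU] <-] /ltW Ub].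
by exists U; split.
Qed.

End Covers.

(** * The family of probability vectors at one scale *)

Section Scale.
Context {R : realType} {X : metricType R}.
Variables (U : set (set X)) (d b c t : R) (N q : nat) (x0 : X).
Hypothesis U_diam : forall A, U A -> forall x y, A x -> A y -> mdist x y <= d.
Hypothesis U_mult : (multiplicity U <= b%:E)%E.
Hypothesis U_ball : forall x, exists2 A, U A & ball x N%:R `<=` A.
Hypotheses (N_gt0 : (0 < N)%N) (t_gt0 : 0 < t) (c_ge0 : 0 <= c).
Hypothesis size_bound : 2 * b * t ^+ q.+1 <= c * N%:R ^+ q.+1.

Let S z : {fset (set X)} := fset_set (U `&` [set A | A z]).

Let SP z A : reflect (U A /\ A z) (A \in S z).
Proof.
rewrite in_fset_set; last exact: multiplicity_finite U_mult.
by apply: (iffP idP); [move/set_mem|move=> UA; apply/mem_set].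
Qed.

Let g z (A : set X) : R := (depth N A z)%:R.
Let w z (A : set X) : R := g z A ^+ q.+1 / \sum_(B <- S z) g z B ^+ q.+1.
(** Members of [S z] contain [z], so [xget] yields a genuine point of each and the default [x0]
    never occurs. *)
Let a z : X -> R := fiber_sum (xget x0) (S z) (w z).

Let g_ge0 z A : 0 <= g z A. Proof. exact: ler0n. Qed.

Let g_notin z A : (A \notin S z) -> U A -> g z A ^+ q.+1 = 0.
Proof.
move=> AS UA; rewrite /g depth_eq0 ?expr0n// => Az.
by move/negP: AS; apply; apply/SP.
Qed.

Let sum_g_ge z : N%:R ^+ q.+1 <= \sum_(A <- S z) g z A ^+ q.+1.
Proof.
have [A UA zA] := U_ball z.
have AS : A \in S z.
  by apply/SP; split=> //; apply/zA/ballxx; rewrite ltr0n.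
rewrite (big_fsetD1 A)//= ler_wpDr ?sumr_ge0// => [i _|].
  exact: exprn_ge0.
by rewrite lerXn2r ?nnegrE// ler_nat depth_ball.
Qed.

Let sum_g_gt0 z : 0 < \sum_(A <- S z) g z A ^+ q.+1.
Proof. by apply: lt_le_trans (sum_g_ge z); rewrite exprn_gt0// ltr0n. Qed.

Let w_ge0 z A : 0 <= w z A.
Proof. by rewrite divr_ge0 ?exprn_ge0// ltW. Qed.

Let a_dist (k : nat) z z' : mdist z z' <= k%:R ->
  (ell1_norm (fun y => (a z y - a z' y)%R) <=
    (4 * q.+1%:R * k%:R * (1 + c) / t)%:E)%E.
Proof.
(* Both vectors are rewritten as sums over the union [s]: a member of [U] missing a point has depth
   0 there, hence weight 0. The union has at most [2 * b] members, whence the factor 2 in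
   [size_bound]. *)
move=> zz'; set s := (S z `|` S z')%fset.
have sU A : A \in s -> U A by rewrite in_fsetU => /orP[/SP[]|/SP[]].
have gs x : x \in [:: z; z'] -> forall F : set X -> R,
    (forall A, g x A ^+ q.+1 = 0 -> F A = 0) ->
    \sum_(A <- S x) F A = \sum_(A <- s) F A.
  move=> xz F F0; apply: big_fset_incl => [|A As AS].
    move: xz; rewrite !inE => /orP[]/eqP ->; first exact: fsubsetUl.
    exact: fsubsetUr.
  by apply: F0; apply: g_notin AS _ => //; exact: sU.
have [gz gz'] : (\sum_(A <- S z) g z A ^+ q.+1 = \sum_(A <- s) g z A ^+ q.+1) /\
    (\sum_(A <- S z') g z' A ^+ q.+1 = \sum_(A <- s) g z' A ^+ q.+1).
  by split; apply: gs => //; rewrite !inE eqxx ?orbT.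
have aE x : x \in [:: z; z'] -> a x = fiber_sum (xget x0) s (w x).
  move=> xz; apply/funext => y; rewrite /a !fiber_sumE; apply: gs => // A A0.
  by rewrite /w A0 mul0r if_same.
rewrite (_ : (fun y => _) =
    fiber_sum (xget x0) s (fun A => w z A - w z' A)); last first.
  apply/funext => y.
  by rewrite fiber_sumB !aE// !inE eqxx ?orbT.
apply: (le_trans (ell1_norm_fiber_sum_le _ _ _)); rewrite lee_fin /w gz gz'.
apply: (@sum_dist_power_weights _ _ _ _ _ _ c k%:R t (N%:R ^+ q.+1)) => //.
- move=> A; rewrite ler_distl lerBlDr -!natrD !ler_nat.
  by rewrite !depth_lipschitz// metric_sym.
- by rewrite exprn_gt0// ltr0n.
- rewrite (le_trans _ size_bound)// ler_wpM2r ?exprn_ge0 ?(ltW t_gt0)//.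
  apply: (@le_trans _ _ (#|` S z|%:R + #|` S z'|%:R)).
    by rewrite -natrD ler_nat leq_card_fsetU.
  rewrite mulr_natl mulr2n; have Sb x : #|` S x|%:R <= b.
    by apply: (multiplicity_card U b x) => // A /SP.
  by rewrite lerD.
- by rewrite -gz.
- by rewrite -gz'.
Qed.

Lemma cover_almost_invariant_family : exists a : X -> X -> R,
  [/\ forall z, ell1 (a z),
      forall z, ell1_norm (a z) = 1%E /\ forall y, 0 <= a z y,
      forall z, [set y | a z y != 0] `<=` ball z (d + 1) &
      forall (k : nat) z z', mdist z z' <= k%:R ->
        (ell1_norm (fun y => (a z y - a z' y)%R) <=
          (4 * q.+1%:R * k%:R * (1 + c) / t)%:E)%E].
Proof.
exists a; split => //.
- by move=> z; exact: summable_fiber_sum.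
- move=> z; split => [|y]; last exact: fiber_sum_ge0.
  by rewrite ell1_norm_fiber_sum// -mulr_suml divff// gt_eqF.
- move=> z y /= azy; rewrite ballEmdist /=.
  have [[A /andP[/SP[UA Az] /eqP <-]]|noA] :=
      pselect (exists A, (A \in S z) && (xget x0 A == y)).
    have Ax := xgetPex x0 (ex_intro _ z Az).
    (* Both [z] and the chosen point lie in [A]; the extra 1 in the radius turns [<= d] into the
       strict inequality of an open ball. *)
    by rewrite (le_lt_trans (U_diam _ UA _ _ Az Ax))// ltrDl.
  move/negP : azy; case; apply/eqP.
  rewrite /a /fiber_sum big_seq_cond big1// => A Ay.
  by case: noA; exists A.
Qed.

End Scale.

(** * Choice of scales and passage to the limit *)

Lemma polynomial_growth_covers {R : realType} {X : metricType R} :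
  polynomial_dimension_growth X ->
  exists (c : R) (k : nat), 0 <= c /\ forall n : nat,
    exists (U : set (set X)) (d b : R),
    [/\ forall A, U A -> forall x y, A x -> A y -> mdist x y <= d,
        (multiplicity U <= b%:E)%E, b <= c * n.+1%:R ^+ k &
        forall x, exists2 A, U A & ball x (n.+1 ^ 2)%:R `<=` A].
Proof.
move=> [p pX]; pose s := \sum_(i < size p) `|p`_i|.
have s0 : 0 <= s by exact: sumr_ge0.
(* The growth bound is applied at [4 * n.+1 ^ 2], strictly above twice the ball radius. The exponent
   doubles because of the square, and the 2 is the loss in [asdim_fun_cover]. *)
exists (s * 4 ^+ size p + 2), (2 * size p)%N; split=> [|n].
  by rewrite addr_ge0 ?mulr_ge0 ?exprn_ge0.
have N1 : 1 <= (n.+1 ^ 2)%:R :> R by rewrite ler1n expn_gt0.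
have l0 : 0 < 4 * (n.+1 ^ 2)%:R :> R by lra.
have [U [/uniformly_boundedP[d Ud] lU Um]] := asdim_fun_cover _ _ (pX _ l0).
exists U, d, (p.[4 * (n.+1 ^ 2)%:R] + 2); split=> //.
  rewrite [leRHS]mulrDl lerD//.
    apply: (le_trans (horner_le_exp _ _ _)); first by lra.
    by rewrite -/s -mulrA ler_wpM2l// exprMn natrX -exprM.
  by rewrite ler_peMr// exprn_ege1// ler1n.
by apply: sup_lebesgue_number_ball lU => //; rewrite -mulr_natl; lra.
Qed.

Theorem theorem3p3 (R : realType) (X : metricType R)
  (X_discrete : forall x : X, open [set x])
  (X_countable : countable [set: X])
  (X_growth : polynomial_dimension_growth X) :
  property_A X.
Proof.
(* The default point [x0] requires [X] to be inhabited; on the empty space the zero family works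
   vacuously. *)
have [[x0]|X0] := pselect (inhabited X); last first.
  have nX (x : X) : False by apply: X0; exists.
  exists (fun _ _ _ => 0); split=> [_ z|_ z||K K0].
  - by case: (nX z).
  - by case: (nX z).
  - by exists (fun=> 0) => _ z; case: (nX z).
  - rewrite (_ : (fun n => _) = cst 0%E); first exact: cvg_cst.
    apply/funext => n; apply/eqP; rewrite eq_le nneg_sup_ge0 andbT.
    by apply: nneg_sup_le => // y [[z z0]]; case: (nX z).
have [c [k [c0 covers]]] := polynomial_growth_covers X_growth.
pose M : R := 4 * k.+1%:R * (1 + 2 * c).
have M0 : 0 <= M by rewrite !mulr_ge0// addr_ge0// mulr_ge0.
have step n : exists ar : (X -> X -> R) * R,
  [/\ forall z, ell1 (ar.1 z),
      forall z, ell1_norm (ar.1 z) = 1%E /\ forall y, 0 <= ar.1 z y,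
      forall z, [set y | ar.1 z y != 0] `<=` ball z ar.2 &
      forall (j : nat) z z', mdist z z' <= j%:R ->
        (ell1_norm (fun y => (ar.1 z y - ar.1 z' y)%R) <=
          (M * j%:R * n.+1%:R^-1)%:E)%E].
  have [U [d [b [Ud Ub bc UN]]]] := covers n.
  have t0 : 0 < n.+1%:R :> R by rewrite ltr0n.
  have [||||a [a1 a2 a3 a4]] := cover_almost_invariant_family
    U d b (2 * c) n.+1%:R (n.+1 ^ 2) k x0 Ud Ub UN.
  - by rewrite expn_gt0.
  - exact: t0.
  - by rewrite mulr_ge0.
  (* With [t = n.+1] and [N = t ^ 2], [N ^+ k.+1] equals [t ^+ k.+1 * t ^+ k.+1]; one factor cancels
     and the other absorbs [b <= c * t ^+ k]. *)
  - rewrite -!mulrA ler_wpM2l// natrX -exprM mul2n -addnn exprD mulrA.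
    rewrite ler_wpM2r ?exprn_ge0 ?ler0n// (le_trans bc)// ler_wpM2l//.
    by rewrite ler_weXn2l// ler1n.
  exists (a, d + 1); split => // j z z' /a4.
  by rewrite /M (_ : 4 * _ * _ * _ = 4 * k.+1%:R * (1 + 2 * c) * j%:R)//; ring.
have {step}[ar arP] := choice step.
exists (fun n => (ar n).1); split=> [n z|n z||K K0].
- by have [] := arP n.
- by have [] := arP n.
- by exists (fun n => (ar n).2) => n; have [] := arP n.
(* An integer above [K] makes the bound [M * j / n.+1] uniform over all pairs at distance less than
   [K]. *)
pose j := Num.bound K.
apply: (@squeeze_cvge _ _ _ _ (cst 0%E) _
  (fun n : nat => (M * j%:R * n.+1%:R^-1)%:E)); last 2 first.
- exact: cvg_cst.
- apply/cvg_EFin; first by near=> n.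
  rewrite -[X in _ --> X](mulr0 (M * j%:R)).
  by apply: cvgMr; exact: cvg_harmonic.
near=> n; rewrite nneg_sup_ge0/=; apply: nneg_sup_le => [|_ [[z z']/= zz' <-]].
  by rewrite lee_fin divr_ge0// mulr_ge0.
have [_ _ _] := arP n; apply.
by rewrite (le_trans (ltW zz'))// ltW// archi_boundP// ltW.
Unshelve. all: by end_near. Qed.
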